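(* Let $X$ be a Hausdorff pseudoradial space. Then $t(X) \leq L(X) \cdot F(X)$.
   Context: A transfinite sequence $\{x_\alpha : \alpha < \kappa\}$ ($\kappa$ an infinite cardinal) converges to a point $x$ if every open neighbourhood of $x$ contains $\{x_\alpha : \beta \leq \alpha < \kappa\}$ for some $\beta < \kappa$. A topological space $X$ is pseudoradial if for every non-closed set $A \subset X$ there are a point $x \in \overline{A} \setminus A$ and a transfinite sequence $\{x_\alpha : \alpha < \kappa\} \subset A$ which converges to $x$. A sequence $\{x_\alpha : \alpha < \kappa\}$ in $X$ is free if $\overline{\{x_\alpha : \alpha < \beta\}} \cap \overline{\{x_\alpha : \beta \leq \alpha < \kappa\}} = \emptyset$ for every $\beta < \kappa$. $F(X)$ is the supremum of the cardinalities of free sequences in $X$. The tightness $t(X)$ is the least infinite cardinal $\kappa$ such that whenever $A \subset X$ and $x \in \overline{A}$ there is $B \subset A$ with $|B| \leq \kappa$ and $x \in \overline{B}$. The Lindelöf degree $L(X)$ is the least infinite cardinal $\kappa$ such that every open cover of $X$ has a subcover of cardinality at most $\kappa$. As is standard, all cardinal functions are taken to be infinite (so $F(X)$ means $\max\{\omega, F(X)\}$). No regularity is assumed. *)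

(* Defs.v *)
From mathcomp Require Import all_boot wochoice.
From mathcomp Require Import all_classical.
From mathcomp Require Import topology.

Set Implicit Arguments.
Unset Strict Implicit.
Unset Printing Implicit Defensive.

Local Open Scope classical_set_scope.
Local Open Scope card_scope.

(* Infinite cardinals are the infinite initial ordinals, up to isomorphism:
   infinite well-ordered types none of whose proper initial segments
   [set b | b < a] is equipotent to the whole type.  Sizes are compared with
   the library relation [#<=]. *)
Record infinite_cardinal := InfiniteCardinal {
  card_sort :> Type;
  card_ord : rel card_sort;
  card_ord_wo : well_order card_ord;
  card_sort_infinite : infinite_set [set: card_sort];
  card_sort_initial : forall a : card_sort,
    ~ ([set: card_sort] #<= [set b | ~~ card_ord a b]) }.

Definition is_least_cardinal (P : infinite_cardinal -> Prop)
    (k : infinite_cardinal) :=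
  P k /\ forall l, P l -> [set: k] #<= [set: l].

Lemma card_family_min (T I : Type) (A : I -> set T) (i0 : I) :
  exists i, forall j, A i #<= A j.
Proof.
pose P (S : set (I -> T)) :=
  (forall f, S f -> forall j, A j (f j)) /\
  (forall f g j, S f -> S g -> f j = g j -> f = g).
have [|S [[SA Sinj] Smax]] := @Zorn_bigcup _ P.
  move=> F FP Ftot; split=> [f [U FU Uf]|f g j [U FU Uf] [V FV Vg]].
    exact: (FP _ FU).1.
  have [UV|VU] := Ftot _ _ FU FV.
    by apply: (FP _ FV).2 => //; exact: UV.
  by apply: (FP _ FU).2 => //; exact: VU.
have [i Ai] : exists i, A i `<=` (fun f => f i) @` S.
  apply: contrapT => /forallNP nA.
  have {nA}/choice[t tP] i : exists x, A i x /\ ~ ((fun f => f i) @` S) x.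
    by have /existsNP[x /not_implyP[]] := nA i; exists x.
  apply: (Smax (S `|` [set t])).
    split=> [|St]; first exact: subsetUl.
    by apply: (tP i0).2; exists t => //; apply: St; right.
  split=> [f [/SA//|-> j]|f g j]; first exact: (tP j).1.
  move=> [Sf|->] [Sg|->] // e; first exact: Sinj e.
  - by case: (tP j).2; exists f.
  - by case: (tP j).2; exists g.
exists i => j; apply: card_le_trans (subset_card_le Ai) _.
apply: card_le_trans (card_image_le _ _) _.
have /card_eqPle[_ +] : (fun f : I -> T => f j) @` S #= S.
  by apply: inj_card_eq => f g /set_mem Sf /set_mem Sg; exact: Sinj.
by move/card_le_trans; apply; apply: subset_card_le => _ [f Sf <-]; exact: SA.
Qed.

Lemma card_le_total (T U : Type) (A : set T) (B : set U) :
  A #<= B \/ B #<= A.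
Proof.
have AE : (@inl T U) @` A #= A by apply: inj_card_eq => x y _ _ [].
have BE : (@inr T U) @` B #= B by apply: inj_card_eq => x y _ _ [].
pose F (b : bool) := if b then (@inl T U) @` A else (@inr T U) @` B.
have [[] Fmin] := @card_family_min _ _ F true.
  by left; have := Fmin false; rewrite /= (card_le_eql AE) (card_le_eqr BE).
by right; have := Fmin true; rewrite /= (card_le_eql BE) (card_le_eqr AE).
Qed.

Lemma card_le_subset (T U : Type) (A : set T) :
  A #<= [set: U] -> exists B : set U, A #= B.
Proof.
move=> /card_leP[f]; exists ((fun a : A => val (f a)) @` setT).
rewrite card_eq_sym (card_eqr (card_setT_sym A)).
by apply: inj_card_eq => a b _ _ /val_inj; apply: inj; rewrite inE.
Qed.

Lemma least_cardinal_exists (P : infinite_cardinal -> Prop) :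
  (exists k, P k) -> exists k, is_least_cardinal P k.
Proof.
move=> [k0 Pk0].
pose I := {S : set k0 | exists2 k, P k & [set: k] #= S}.
have i0 : I by exists setT; exists k0.
have [[S [k Pk kS]] /= Smin] := card_family_min (fun i : I => sval i) i0.
exists k; split=> // l Pl; rewrite (card_le_eql kS).
have [k0l|/card_le_subset[S' lS']] := @card_le_total _ _ [set: k0] [set: l].
  exact: card_le_trans (card_leT S) k0l.
have := Smin (exist _ S' (ex_intro2 _ _ l Pl lS')) => /=.
by rewrite (card_le_eqr lS').
Qed.

Lemma infinite_cardinal_of (T : Type) :
  infinite_set [set: T] -> exists k : infinite_cardinal, [set: k] #= [set: T].
Proof.
elim/Peq : T => T Tinf; have [R Rwo] := well_ordering_principle T.
have Rrefl : reflexive R.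
  move=> x; have [|z [[/eqP zx zmin] _]] := Rwo (pred1 x).
    by exists x; rewrite inE.
  by have := zmin x; rewrite zx inE; apply.
have Rtrans : transitive R.
  move=> y x z Rxy Ryz.
  have Ranti a b : R a b -> R b a -> a = b.
    move=> Rab Rba; have [|m [_ muniq]] := Rwo (pred2 a b).
      by exists a; rewrite !inE eqxx.
    have mE c : c \in pred2 a b -> m = c.
      move=> cab; apply: muniq; split=> // d; rewrite inE => /orP[]/eqP->;
      by move: cab; rewrite inE => /orP[]/eqP->.
    by rewrite -(mE a) ?inE ?eqxx// -(mE b) ?inE ?eqxx ?orbT.
  have [|m [[+ mmin] _]] := Rwo (pred3 x y z).
    by exists x; rewrite !inE eqxx.
  rewrite inE => /or3P[]/eqP mE; subst m.
  - by apply: mmin; rewrite !inE eqxx !orbT.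
  - suff -> : x = y by [].
    by apply: Ranti => //; apply: mmin; rewrite !inE eqxx.
  - suff <- : y = z by [].
    by apply: Ranti => //; apply: mmin; rewrite !inE eqxx ?orbT.
have Rtot x y : ~~ R x y -> R y x.
  move=> nRxy; have [|m [[+ mmin] _]] := Rwo (pred2 x y).
    by exists x; rewrite !inE eqxx.
  rewrite inE => /orP[]/eqP mE; subst m.
    by case/negP: nRxy; apply: mmin; rewrite !inE eqxx orbT.
  by apply: mmin; rewrite !inE eqxx.
pose seg a := [set b | ~~ R a b].
have [[a aT]|/forallNP noseg] := pselect (exists a, [set: T] #<= seg a); last first.
  by exists (InfiniteCardinal Rwo Tinf noseg).
have [|m [[/asboolP mT mmin] _]] := Rwo (fun a => `[< [set: T] #<= seg a >]).
  by exists a; apply/asboolP.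
have segT : [set: seg m] #= [set: T].
  rewrite (card_eql (card_setT (seg m))).
  by apply/card_eqPle; split=> //; exact: card_leT.
pose Rm : rel (seg m) := fun x y => R (val x) (val y).
have Rmwo : well_order Rm.
  move=> A [x xA].
  pose A' : {pred T} := fun t => `[< exists2 y : seg m, y \in A & val y = t >].
  have [|z [[/asboolP[y yA yz] zmin] zuniq]] := Rwo A'.
    by exists (val x); apply/asboolP; exists x.
  exists y; split=> [|w [wA wmin]].
    by split=> // w wA; rewrite /Rm yz; apply: zmin; apply/asboolP; exists w.
  apply: val_inj; rewrite yz; apply: zuniq; split.
    by apply/asboolP; exists w.
  by move=> _ /asboolP[v vA <-]; exact: wmin.
have Rminf : infinite_set [set: seg m].
  by move: Tinf; rewrite !infiniteP (card_le_eqr segT).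
have Rminit (x : seg m) : ~ ([set: seg m] #<= [set y | ~~ Rm x y]).
  move=> le; have xm : ~~ R m (val x) by exact: set_valP x.
  suff xT : [set: T] #<= seg (val x).
    by case/negP: xm; apply: mmin; exact/asboolP.
  rewrite -(card_le_eql segT); apply: card_le_trans le _.
  have /card_eqPle[_ le] : (val : seg m -> T) @` [set y | ~~ Rm x y] #= [set y | ~~ Rm x y].
    by apply: inj_card_eq => u v _ _; exact: val_inj.
  by apply: card_le_trans le _; apply: subset_card_le => _ [y xy <-].
by exists (InfiniteCardinal Rmwo Rminf Rminit).
Qed.

Lemma infinite_cardinal_ge (T : Type) :
  exists k : infinite_cardinal, [set: T] #<= [set: k].
Proof.
have inlE : (@inl T nat) @` setT #= [set: T] by apply: inj_card_eq => x y _ _ [].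
have inrE : (@inr T nat) @` setT #= [set: nat] by apply: inj_card_eq => x y _ _ [].
have [|k kE] := @infinite_cardinal_of (T + nat)%type.
  by apply/infiniteP; rewrite -(card_le_eql inrE); exact: card_leT.
by exists k; rewrite (card_le_eqr kE) -(card_le_eql inlE); exact: card_leT.
Qed.

(* [card_ord] is reflexive, so [~~ card_ord b a] is the strict a < b. *)
Definition before (k : infinite_cardinal) (b : k) : set k :=
  [set a | ~~ card_ord b a].
Definition from (k : infinite_cardinal) (b : k) : set k :=
  [set a | card_ord b a].

Definition transfinite_cvg (X : topologicalType) (k : infinite_cardinal)
    (x : k -> X) (p : X) :=
  forall U, open_nbhs p U -> exists b : k, x @` from b `<=` U.

Definition pseudoradial (X : topologicalType) :=
  forall A : set X, ~ closed A ->
    exists2 p, (closure A `\` A) p &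
    exists (k : infinite_cardinal) (x : k -> X),
      range x `<=` A /\ transfinite_cvg x p.

Definition free_sequence (X : topologicalType) (k : infinite_cardinal)
    (x : k -> X) :=
  forall b : k, closure (x @` before b) `&` closure (x @` from b) = set0.

(* Each cardinal function below is the least infinite cardinal in a class that
   is shown to be inhabited. *)

Definition tightness_bound (X : topologicalType) (k : infinite_cardinal) :=
  forall (A : set X) (p : X), closure A p ->
    exists B, [/\ B `<=` A, B #<= [set: k] & closure B p].

Definition lindelof_bound (X : topologicalType) (k : infinite_cardinal) :=
  forall U : set (set X), U `<=` open -> cover U id = setT ->
    exists V, [/\ V `<=` U, V #<= [set: k] & cover V id = setT].

Definition free_bound (X : topologicalType) (k : infinite_cardinal) :=
  forall (l : infinite_cardinal) (x : l -> X),
    free_sequence x -> range x #<= [set: k].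

Lemma tightness_bound_exists (X : topologicalType) :
  exists k, tightness_bound X k.
Proof.
have [k Xk] := infinite_cardinal_ge X; exists k => A p Ap; exists A; split=> //.
exact: card_le_trans (card_leT A) Xk.
Qed.

Lemma lindelof_bound_exists (X : topologicalType) :
  exists k, lindelof_bound X k.
Proof.
have [k Xk] := infinite_cardinal_ge (set X); exists k => U _ UX.
by exists U; split=> //; exact: card_le_trans (card_leT U) Xk.
Qed.

Lemma free_bound_exists (X : topologicalType) : exists k, free_bound X k.
Proof.
have [k Xk] := infinite_cardinal_ge X; exists k => l x _.
exact: card_le_trans (card_leT _) Xk.
Qed.

Definition tightness (X : topologicalType) : infinite_cardinal :=
  sval (cid (least_cardinal_exists (tightness_bound_exists X))).

Definition lindelof_degree (X : topologicalType) : infinite_cardinal :=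
  sval (cid (least_cardinal_exists (lindelof_bound_exists X))).

(* The least upper bound is taken among infinite cardinals, which gives
   max(omega, sup) of the cardinalities of the free sequences. *)
Definition free_number (X : topologicalType) : infinite_cardinal :=
  sval (cid (least_cardinal_exists (free_bound_exists X))).

Lemma tightnessP (X : topologicalType) :
  is_least_cardinal (tightness_bound X) (tightness X).
Proof. exact: svalP. Qed.

Lemma lindelof_degreeP (X : topologicalType) :
  is_least_cardinal (lindelof_bound X) (lindelof_degree X).
Proof. exact: svalP. Qed.

Lemma free_numberP (X : topologicalType) :
  is_least_cardinal (free_bound X) (free_number X).
Proof. exact: svalP. Qed.

(* Main.v *)
Require Import Defs.
From mathcomp Require Import all_boot.
From mathcomp Require Import all_classical.
From mathcomp Require Import topology.
From Stdlib Require Import Wellfounded Relation_Operators.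
(* The name [card_ord] also belongs to [fintype]. *)
Import Defs.

(** Let k be an infinite cardinal that bounds both the Lindelof degree and the
free sequences; the larger of L(X) and F(X) is such a k.  It suffices to show
that k bounds the tightness.

Given A, let C be the union of the closures of the subsets of A of size at most
k.  Since k * k = k ([card_square]), k many such subsets can be merged into one,
so C contains the closure of each of its own subsets of size at most k.
If C were not closed, pseudoradiality would give a transfinite sequence y in C
converging to a point p outside C; so it is enough that such a limit p always
lies in the closure of at most k terms of y
([transfinite_limit_small_closure]).

Suppose it does not.  Then no k many indices are cofinal, since the terms at
cofinal indices accumulate at p.  The Hausdorff property, the Lindelof bound and
the convergence of y then separate the closure of any k many terms from the
closure of some tail of y ([tail_separation]).  By recursion along the successor
of k, choose for each stage a an index f a which is above all previous indices
and whose tail has a closure disjoint from the closure of the previously chosen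
terms.  The terms after stage a lie in that tail, so the chosen terms form a
free sequence; its terms are distinct, so its range has more than k elements,
against the choice of k. *)

Set Implicit Arguments.
Unset Strict Implicit.
Unset Printing Implicit Defensive.

Local Open Scope classical_set_scope.
Local Open Scope card_scope.

(** * The well-order of an infinite cardinal *)

Section CardinalOrder.
Context {k : infinite_cardinal}.
Implicit Types (a b c : k) (A : set k).

Lemma card_ord_min A : A !=set0 ->
  exists2 m, A m & forall a, A a -> card_ord m a.
Proof.
move=> [a Aa]; have [|m [[/asboolP Am mmin] _]] :=
  @card_ord_wo k (fun a => `[< A a >]); first by exists a; exact/asboolP.
by exists m => // b Ab; apply: mmin; exact/asboolP.
Qed.

Lemma card_ord_total a b : card_ord a b \/ card_ord b a.
Proof.
have [|m [->|->] mmin] := @card_ord_min [set a; b]; first by exists a; left.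
  by left; apply: mmin; right.
by right; apply: mmin; left.
Qed.

Lemma card_ord_refl a : card_ord a a.
Proof. by case: (card_ord_total a a). Qed.

Lemma card_ord_anti a b : card_ord a b -> card_ord b a -> a = b.
Proof.
move=> ab ba; have [|m [_ muniq]] :=
  @card_ord_wo k (fun c => `[< c = a \/ c = b >]).
  by exists a; apply/asboolP; left.
have mE c : c = a \/ c = b -> m = c.
  move=> cab; apply: muniq; split=> [|d /asboolP dab]; first exact/asboolP.
  by case: cab dab => -> [] ->; rewrite ?ab ?ba ?card_ord_refl.
by rewrite -(mE a) ?(mE b); [| right | left].
Qed.

Lemma card_ord_trans b a c : card_ord a b -> card_ord b c -> card_ord a c.
Proof.
move=> ab bc.
have [|m + mmin] := @card_ord_min [set d | [\/ d = a, d = b | d = c]].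
  by exists a; constructor 1.
have ma : card_ord m a by apply: mmin; constructor 1.
have mb : card_ord m b by apply: mmin; constructor 2.
have mc : card_ord m c by apply: mmin; constructor 3.
case=> mE; subst m => //; first by rewrite (card_ord_anti ab ma).
by rewrite -(card_ord_anti bc mb).
Qed.

Lemma before_trichotomy a b : a <> b -> before b a \/ before a b.
Proof.
move=> ab; have [|nba] := boolP (card_ord b a); last by left.
have [ab' ba|nab _] := boolP (card_ord a b); last by right.
by case: ab; exact: card_ord_anti.
Qed.

Lemma before_ord a b : before b a -> card_ord a b.
Proof. by move/negP; case: (card_ord_total a b). Qed.

Lemma before_wf : well_founded (fun a b : k => before b a).
Proof.
move=> a; apply: contrapT => na.
have [m nm mmin] := @card_ord_min [set b | ~ Acc (fun a b : k => before b a) b]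
  (ex_intro _ a na).
by apply: nm; constructor => b /negP bm; apply: contrapT => /mmin.
Qed.

End CardinalOrder.

(** Transfinite recursion in which a value depends only on the set of earlier
values.  This is enough both for enumerating without repetition and for the free
sequence, and it spares any bookkeeping of the functions defined so far. *)
Lemma wf_set_recursion (T Y : Type) (lt : T -> T -> Prop) (c : set Y -> Y) :
  well_founded lt -> exists f : T -> Y, forall t, f t = c (f @` (lt^~ t)).
Proof.
move=> wf.
pose F t (rec : forall s, lt s t -> Y) :=
  c [set y | exists s (st : lt s t), rec s st = y].
exists (Fix wf (fun=> Y) F) => t; rewrite Fix_eq.
  congr c; apply/seteqP; split=> y /=; first by move=> [s [st <-]]; exists s.
  by move=> [s st <-]; exists s, st.
move=> s f g fg; congr c; apply/funext => y.
by apply/propext; split=> -[r [rs <-]]; exists r, rs.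
Qed.

(** * Cardinal arithmetic *)

Lemma inj_card_leT (T U : Type) (A : set T) (f : T -> U) :
  (forall x y, A x -> A y -> f x = f y -> x = y) -> A #<= [set: U].
Proof.
move=> finj; have : f @` A #= A.
  by apply: inj_card_eq => x y /set_mem Ax /set_mem Ay; exact: finj.
by rewrite card_eq_sym => /card_le_eql ->; exact: card_leT.
Qed.
Arguments inj_card_leT {T U A} f _.

Lemma infinite_cardinal_inhabited (k : infinite_cardinal) : inhabited k.
Proof. by have [a _] := infinite_setN0 (@card_sort_infinite k). Qed.

Lemma card_leT_inj (T : Type) (A : set T) (k : infinite_cardinal) :
  A #<= [set: k] ->
  exists f : T -> k, forall x y, A x -> A y -> f x = f y -> x = y.
Proof.
have [a] := infinite_cardinal_inhabited k.
move: (card_sort k) a => U; elim/Ppointed: U => U a; first by case: (no a).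
by move=> /pcard_injP[f finj]; exists f => x y Ax Ay; apply: finj; rewrite inE.
Qed.

Lemma card_le_infinite {T U : Type} {A : set T} {B : set U} :
  infinite_set A -> A #<= B -> infinite_set B.
Proof. by move=> Ainf AB /(card_le_finite AB). Qed.

Lemma card_bigcup_le (I T : Type) (D : set I) (F : I -> set T)
    (k : infinite_cardinal) :
  [set: k * k] #<= [set: k] -> D #<= [set: k] ->
  (forall i, D i -> F i #<= [set: k]) -> \bigcup_(i in D) F i #<= [set: k].
Proof.
move=> kk /card_leT_inj[f finj] Fk.
have /choice[g ginj] i : exists g : T -> k,
    D i -> forall x y, F i x -> F i y -> g x = g y -> x = y.
  have [Di|nDi] := pselect (D i).
    by have /card_leT_inj[g] := Fk i Di; exists g.
  by have [a] := infinite_cardinal_inhabited k; exists (fun=> a).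
apply: card_le_trans kk.
have [[i0]|noI] := pselect (inhabited I); last first.
  by rewrite (_ : \bigcup_(i in D) F i = set0) ?card_ge0//
    -subset0 => x [i]; case: noI.
have /choice[h hP] x : exists i, (\bigcup_(i in D) F i) x -> D i /\ F i x.
  have [[i Di Fix]|nx] := pselect ((\bigcup_(i in D) F i) x); first by exists i.
  by exists i0.
apply: (inj_card_leT (fun x => (f (h x), g (h x) x))) => x y.
move=> /hP[Dx Fx] /hP[Dy Fy] [/finj hxy gxy]; have {}hxy := hxy Dx Dy.
by rewrite -hxy in Fy gxy; exact: (ginj (h x)).
Qed.

Lemma finite_card_le (T : Type) (A : set T) (k : infinite_cardinal) :
  finite_set A -> A #<= [set: k].
Proof.
move=> /finite_set_countable/card_le_trans; apply.
exact/infiniteP/card_sort_infinite.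
Qed.

Definition card_max {k : infinite_cardinal} (z : k * k) : k :=
  if card_ord z.1 z.2 then z.2 else z.1.

Lemma card_ord_max (k : infinite_cardinal) (z : k * k) :
  card_ord z.1 (card_max z) /\ card_ord z.2 (card_max z).
Proof.
rewrite /card_max; case: ifPn => zz; split=> //; try exact: card_ord_refl.
exact: before_ord.
Qed.

(** Godel's well-order of the pairs: lexicographic in the maximum, the first and
the second coordinate.  Comparing maxima first is what makes the initial
segments small. *)
Definition godel_lt {k : infinite_cardinal} (z w : k * k) : Prop :=
  slexprod k (k * k) (fun a b => before b a)
    (slexprod k k (fun a b => before b a) (fun a b => before b a))
    (card_max z, z) (card_max w, w).

Lemma godel_lt_wf (k : infinite_cardinal) : well_founded (@godel_lt k).
Proof.
apply: (wf_inverse_image _ _ _ (fun z => (card_max z, z))).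
by do 2?apply: wf_slexprod; exact: before_wf.
Qed.

Lemma godel_lt_trichotomy (k : infinite_cardinal) (z w : k * k) :
  z <> w -> godel_lt z w \/ godel_lt w z.
Proof.
move=> zw; rewrite /godel_lt.
have [e|/before_trichotomy[]] := pselect (card_max z = card_max w);
  last 2 first.
- by left; constructor.
- by right; constructor.
rewrite e; case: z w zw {e} => [z1 z2] [w1 w2] zw.
have [e|/before_trichotomy[]] := pselect (z1 = w1); last 2 first.
- by left; do 2 constructor.
- by right; do 2 constructor.
rewrite {}e in zw *.
have /before_trichotomy[] : z2 <> w2 by move=> e; apply: zw; rewrite e.
- by left; do 2 constructor.
- by right; do 2 constructor.
Qed.

Lemma godel_lt_max (k : infinite_cardinal) (z w : k * k) :
  godel_lt z w -> card_ord (card_max z) (card_max w).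
Proof.
rewrite /godel_lt => zw; inversion zw; first exact: before_ord.
exact: card_ord_refl.
Qed.

Lemma godel_lt_initial (k : infinite_cardinal) (z : k * k) :
  godel_lt^~ z `<=`
    [set a | card_ord a (card_max z)] `*` [set a | card_ord a (card_max z)].
Proof.
by move=> w /godel_lt_max wz; have [w1 w2] := card_ord_max w;
  split; exact: card_ord_trans wz.
Qed.

(** Hessenberg's theorem.  At a least counterexample k, the segment of pairs
below z in Godel's order lies in S * S, where S is the segment of k up to the
maximum of z; as S is smaller than k, either it is finite or its cardinal
satisfies the theorem, so S * S is smaller than k too.  Running through the
pairs in Godel's order one can therefore always assign to the next pair an
element of k that is not yet taken, and the result is an injection of k * k
into k. *)
Lemma card_square (k : infinite_cardinal) : [set: k * k] #<= [set: k].
Proof.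
pose P (k : infinite_cardinal) := ~ ([set: k * k] #<= [set: k]).
apply: contrapT => nk.
have [{nk}k [nk kmin]] := @least_cardinal_exists P (ex_intro _ k nk).
apply: nk.
have small (z : k * k) : ~ ([set: k] #<= godel_lt^~ z).
  pose m := card_max z; pose S := [set a : k | card_ord a m].
  suff nS : ~ ([set: k] #<= S `*` S).
    by move/card_le_trans/(_ (subset_card_le (@godel_lt_initial k z))).
  have SE : S = before m `|` [set m].
    apply/seteqP; split=> a /=; last first.
      by case=> [/before_ord//|->]; exact: card_ord_refl.
    move=> am.
    have [->|/before_trichotomy[]] := pselect (a = m); try by [right|left].
    by rewrite /before /= am.
  have [finm|infm] := pselect (finite_set (before m)).
    have finS : finite_set S by rewrite SE finite_setU; split.
    move/card_le_finite/(_ (finite_setX finS finS)).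
    exact: card_sort_infinite.
  have [|l lm] := @infinite_cardinal_of (before m).
    by apply: card_le_infinite infm _; rewrite (card_le_eqr (card_setT _)).
  have {}lm := card_eq_trans lm (card_setT _).
  have nkl : ~ ([set: k] #<= [set: l]).
    by rewrite (card_le_eqr lm); exact: card_sort_initial.
  have ll : [set: l * l] #<= [set: l] by apply: contrapT => /kmin.
  (* S has one more point than the segment before m, which is absorbed. *)
  have Sl : S #<= [set: l].
    rewrite SE -bigcup2E; apply: card_bigcup_le => //.
      exact/infiniteP/card_sort_infinite.
    move=> [|[|i]] _ /=; last exact: card_ge0.
      by rewrite (card_le_eqr lm).
    exact/finite_card_le/finite_set1.
  move=> kS; apply: nkl; apply: card_le_trans kS _.
  apply: card_le_trans ll; have [g ginj] := card_leT_inj Sl.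
  apply: (inj_card_leT (fun w => (g w.1, g w.2))).
  move=> [a b] [a' b'] [/= Sa Sb] [/= Sa' Sb'] [/ginj e1 /ginj e2].
  by rewrite (e1 Sa Sa') (e2 Sb Sb').
have /choice[c cP] (S : set k) : exists a, ~ ([set: k] #<= S) -> ~ S a.
  have [->|] := pselect (S = setT).
    by have [a] := infinite_cardinal_inhabited k; exists a.
  by rewrite -subTset => /existsNP[a /not_implyP[_ Sa]]; exists a.
have [f fE] := wf_set_recursion c (@godel_lt_wf k).
have fN z w : godel_lt z w -> f z <> f w.
  move=> zw e; have : ~ (f @` (godel_lt^~ w)) (f w).
    have := cP (f @` (godel_lt^~ w)); rewrite -fE; apply => kw.
    apply: (small w).
    exact: card_le_trans kw (card_image_le _ _).
  by apply; exists z.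
apply: (inj_card_leT f) => z w _ _ e.
by apply: contrapT => /godel_lt_trichotomy[/fN|/fN]; rewrite e; apply.
Qed.

(** The successor of k is taken as the least infinite cardinal that does not
embed in k; leastness and initiality make its proper segments embed in k. *)
Lemma card_successor (k : infinite_cardinal) : exists2 l : infinite_cardinal,
  ~ ([set: l] #<= [set: k]) & forall a : l, before a #<= [set: k].
Proof.
pose P (l : infinite_cardinal) := ~ ([set: l] #<= [set: k]).
have [|l [nlk lmin]] := @least_cardinal_exists P.
  have [l lP] := infinite_cardinal_ge (set k); exists l => /(card_le_trans lP).
  move=> /card_leT_inj[f finj].
  (* Cantor's diagonal argument against an injection of [set k] into k. *)
  pose D := [set a | exists2 S, f S = a & ~ S a].
  have [[S fS nS]|nD] := pselect (D (f D)); last by apply: (nD); exists D.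
  by apply: (nS); rewrite (finj S D) //; exists S.
exists l => // a; apply: contrapT => nak.
have infa : infinite_set (before a).
  by move=> fina; apply: nak; exact: finite_card_le.
have [|m ma] := @infinite_cardinal_of (before a).
  by apply: card_le_infinite infa _; rewrite (card_le_eqr (card_setT _)).
have {}ma := card_eq_trans ma (card_setT _).
apply: (@card_sort_initial l a); rewrite -(card_le_eqr ma); apply: lmin.
by rewrite /P (card_le_eql ma).
Qed.

(** * Free sequences from convergent transfinite sequences *)

Section Topology.
Context {X : topologicalType}.
Implicit Types (k l : infinite_cardinal).

(** A point other than p has, by the Hausdorff property and convergence, an open
neighbourhood that misses a tail of y; p itself lies in the complement of the
closure of [y @` S].  By the Lindelof bound, k of these open sets cover X, and
then those that miss a tail cover the closure of [y @` S].  The starting points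
of the missed tails are not cofinal, so a single tail is missed by all of these
open sets, hence so is its closure. *)
Lemma tail_separation k l (y : l -> X) (p : X) (S : set l) :
  hausdorff_space X -> lindelof_bound X k ->
  (forall B : set l, B #<= [set: k] ->
    exists c, forall b, B b -> card_ord b c) ->
  transfinite_cvg y p -> ~ closure (y @` S) p ->
  exists c, closure (y @` S) `&` closure (y @` from c) = set0.
Proof.
move=> hX Lk bnd yp nSp.
pose tail c (U : set X) := U `&` y @` from c = set0.
pose UU := [set U | open U /\
  ((exists c, tail c U) \/ U = ~` closure (y @` S))].
have [||V [VU Vk Vcov]] := Lk UU; first by move=> U [].
  apply/seteqP; split=> // q _.
  have [->|/eqP qp] := pselect (q = p).
    exists (~` closure (y @` S)) => //; split; last by right.
    by apply: closed_openC; exact: closed_closure.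
  move: hX; rewrite open_hausdorff => /(_ q p qp)[[U W] /=].
  move=> [/set_mem qU /set_mem pW] [oU oW /eqP UW].
  exists U => //; split=> //; left; have [c cW] := yp W (conj oW pW).
  by exists c; apply/seteqP; split=> // x [Ux /cW Wx]; rewrite -UW; split.
have [l0] := infinite_cardinal_inhabited l.
have /choice[g gP] U : exists c, (exists c, tail c U) -> tail c U.
  by have [[c cU]|] := pselect (exists c, tail c U); [exists c|exists l0].
have [|c cP] := bnd (g @` V); first exact: card_le_trans (card_image_le _ _) Vk.
exists c; apply/seteqP; split=> // q [Sq cq].
have [U VU' Uq] : cover V id q by rewrite Vcov.
have [oU [tU|UE]] := VU _ VU'; last by move: Uq; rewrite UE.
have [z [[a ca <-] Uz]] := cq U (open_nbhs_nbhs (conj oU Uq)).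
suff : set0 (y a) by [].
rewrite -(gP U tU); split=> //; exists a => //.
by apply: card_ord_trans ca; apply: cP; exists U.
Qed.

(** Two equal terms would put a common point in the closures of an initial and
of a final part. *)
Lemma free_sequence_inj l (x : l -> X) : free_sequence x -> injective x.
Proof.
move=> xfree a b xab; apply: contrapT.
have N c d : before d c -> x c <> x d.
  move=> cd e; have : (closure (x @` before d) `&` closure (x @` from d)) (x d).
    split; apply: subset_closure; first by exists c.
    by exists d => //; exact: card_ord_refl.
  by rewrite xfree.
by move=> /before_trichotomy[/N|/N]; rewrite xab; apply.
Qed.

(** Otherwise p would avoid the closure of every k many terms, [tail_separation]
would apply to every set of at most k indices, and iterating it along the
successor of k would produce a free sequence that is too long. *)
Lemma transfinite_limit_small_closure k l (y : l -> X) (p : X) :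
  hausdorff_space X -> lindelof_bound X k -> free_bound X k ->
  transfinite_cvg y p ->
  exists B, [/\ B `<=` range y, B #<= [set: k] & closure B p].
Proof.
move=> hX Lk Fk yp; apply: contrapT => nB.
have small (S : set l) : S #<= [set: k] -> ~ closure (y @` S) p.
  move=> Sk Sp; apply: nB; exists (y @` S); split=> //.
    by move=> _ [a _ <-]; exists a.
  exact: card_le_trans (card_image_le _ _) Sk.
(* Terms at cofinal indices accumulate at p, so small index sets are bounded. *)
have bnd (S : set l) : S #<= [set: k] ->
    exists c, forall b, S b -> card_ord b c.
  move=> Sk; apply: contrapT => nS; apply: (small S Sk) => U.
  rewrite nbhsE => -[W [oW Wp] WU]; have [c cW] := yp W (conj oW Wp).
  apply: contrapT => SU; apply: nS; exists c => b Sb.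
  apply: contrapT => /negP/before_ord cb; apply: SU.
  by exists (y b); split; [exists b | apply: WU; apply: cW; exists b].
have /choice[c cP] (S : set l) : exists c, S #<= [set: k] ->
    (forall b, S b -> card_ord b c) /\
    closure (y @` S) `&` closure (y @` from c) = set0.
  have [Sk|nSk] := pselect (S #<= [set: k]); last first.
    by have [a] := infinite_cardinal_inhabited l; exists a.
  have [c1 c1P] := bnd S Sk.
  have [c2 c2P] := tail_separation hX Lk bnd yp (small _ Sk).
  have [c12|c21] := card_ord_total c1 c2.
    by exists c2 => _; split=> // b /c1P/card_ord_trans; exact.
  exists c1 => _; split=> //; rewrite -subset0 -c2P; apply: setIS.
  by apply: closureS; apply: image_subset => a; exact: card_ord_trans.
have [s nsk sk] := card_successor k.
have [f fE] := wf_set_recursion c (@before_wf s).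
have fP a : (forall b, before a b -> card_ord (f b) (f a)) /\
    closure (y @` (f @` before a)) `&` closure (y @` from (f a)) = set0.
  have [|f1 f2] := cP (f @` before a).
    exact: card_le_trans (card_image_le _ _) (sk a).
  by rewrite fE; split=> // b ba; apply: f1; exists b.
(* The chosen indices increase, so all terms from stage a on lie in the tail
   selected at stage a. *)
have fmono a b : card_ord a b -> card_ord (f a) (f b).
  move=> ab; have [->|/before_trichotomy[/(fP b).1//|]] := pselect (a = b).
    exact: card_ord_refl.
  by rewrite /before /= ab.
have yfree : free_sequence (y \o f).
  move=> a; rewrite -subset0 -(fP a).2; apply: setISS; apply: closureS.
    by rewrite image_comp.
  by move=> _ [b ab <-]; exists (f b) => //; exact: fmono.
apply: nsk; apply: card_le_trans (Fk _ _ yfree).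
have /card_eqPle[] // : range (y \o f) #= [set: s].
by apply: inj_card_eq => a b _ _; exact: free_sequence_inj.
Qed.

(** The points that lie in the closure of at most k points of A form a closed
set: a limit of a transfinite sequence of such points lies in the closure of at
most k of them, and hence in that of at most k * k points of A. *)
Lemma tightness_bound_of_lindelof_free k :
  hausdorff_space X -> pseudoradial X -> lindelof_bound X k -> free_bound X k ->
  tightness_bound X k.
Proof.
move=> hX psX Lk Fk A.
pose C := [set q | exists B, [/\ B `<=` A, B #<= [set: k] & closure B q]].
suff Ccl : closed C.
  move=> p Ap; apply: Ccl; apply: closureS Ap => q Aq; exists [set q].
  split=> [_ ->//||]; first exact/finite_card_le/finite_set1.
  exact: subset_closure.
apply: contrapT => /psX[p [Cp nC] [l [y [yC yp]]]]; apply: nC.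
have [B [By Bk Bp]] := transfinite_limit_small_closure hX Lk Fk yp.
have /choice[D DP] q : exists D, C q ->
    [/\ D `<=` A, D #<= [set: k] & closure D q].
  by have [[D ?]|] := pselect (C q); [exists D | exists set0].
have BC q : B q -> C q by move=> /By/yC.
exists (\bigcup_(q in B) D q); split.
- by move=> x [q /BC/DP[DA _ _] /DA].
- by apply: card_bigcup_le => //; [exact: card_square | move=> q /BC/DP[]].
- apply: (@closed_closure _ _ p); move: Bp; apply: closureS => q Bq.
  have [_ _ Dq] := DP q (BC q Bq).
  by move: Dq; apply: closureS => x Dx; exists q.
Qed.

End Topology.

Unset Implicit Arguments.
Set Strict Implicit.
Set Printing Implicit Defensive.

Theorem theorem2 (X : topologicalType)
    (hausdorffX : hausdorff_space X) (pseudoradialX : pseudoradial X) :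
  [set: tightness X] #<= [set: lindelof_degree X] `*` [set: free_number X].
Proof.
have [Lk _] := lindelof_degreeP X; have [Fk _] := free_numberP X.
have [_ tmin] := tightnessP X.
set L := lindelof_degree X in Lk *; set F := free_number X in Fk *.
have [a] := infinite_cardinal_inhabited L.
have [b] := infinite_cardinal_inhabited F.
rewrite setXTT; have [LF|FL] := card_le_total [set: L] [set: F].
  apply: (@card_le_trans _ _ _ [set: F]); last first.
    by apply: (inj_card_leT (pair a)) => x y _ _ [].
  apply: tmin; apply: tightness_bound_of_lindelof_free => // U Uo /(Lk _ Uo).
  by move=> [V [VU Vk VX]]; exists V; split=> //; exact: card_le_trans LF.
apply: (@card_le_trans _ _ _ [set: L]); last first.
  by apply: (inj_card_leT (fun x => (x, b))) => x y _ _ [].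
apply: tmin; apply: tightness_bound_of_lindelof_free => // l x /Fk xF.
exact: card_le_trans FL.
Qed.
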